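(* Let $\mathcal C$ be a non-empty class of Banach lattices, $E$ a Banach space, $F$ a closed subspace of $E$ with inclusion $\iota:F\to E$, and let $\overline\iota=\widehat{\phi_E\iota}:\mathrm{FBL}^{\mathcal C}[F]\to\mathrm{FBL}^{\mathcal C}[E]$ (on $\mathrm{FVL}[F]$ it is given by $\overline\iota f=f\circ\iota^*|_{B_{E^*}}$). The following are equivalent: (1) for every $X\in\overline{\mathcal C}$, every bounded linear operator $T:F\to X$ has a bounded linear extension $\widetilde T:E\to X$ with $\|\widetilde T\|=\|T\|$; (2) $\overline\iota$ is a lattice isometric embedding and there is a contractive lattice homomorphic projection from $\mathrm{FBL}^{\mathcal C}[E]$ onto $\overline\iota(\mathrm{FBL}^{\mathcal C}[F])$.
   Context: $\mathrm{FVL}[E]$ is the vector sublattice of $C(B_{E^*})$ ($B_{E^*}$ weak$^*$) generated by $\delta_x(x^* )=x^*(x)$, $x\in E$; $\phi_E(x)=\delta_x$. A linear $T:E\to Y$ (Archimedean $Y$) extends uniquely to a vector lattice homomorphism $\widehat T$ on $\mathrm{FVL}[E]$ with $\widehat T\phi_E=T$. $\rho_{\mathcal C}(f)=\sup\{\|\widehat Tf\|_Y:Y\in\mathcal C,\ T:E\to Y\text{ linear contraction}\}$, $\mathrm{FBL}^{\mathcal C}[E]$ is the completion of $(\mathrm{FVL}[E],\rho_{\mathcal C})$, and for $Y\in\overline{\mathcal C}$ and bounded $T:E\to Y$, $\widehat T$ extends to a lattice homomorphism $\mathrm{FBL}^{\mathcal C}[E]\to Y$ with $\|\widehat T\|=\|T\|$.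 $\overline{\mathcal C}$ is the class of Banach lattices lattice isometric to a closed sublattice of some $(\bigoplus_{\gamma\in\Gamma}X_\gamma)_\infty$ with $X_\gamma\in\mathcal C$. *)

(* Defs.v *)
From HB Require Import structures.
From mathcomp Require Import all_boot all_order all_algebra.
From mathcomp Require Import all_classical all_reals all_analysis.
Set Implicit Arguments. Unset Strict Implicit. Unset Printing Implicit Defensive.
Import Order.TTheory GRing.Theory Num.Theory.
Import numFieldNormedType.Exports.
Local Open Scope classical_set_scope.
Local Open Scope ring_scope.

(* The order is x <= y  iff  sup x y = y.                               *)
Record banachLattice (R : realType) := BanachLattice {
  bl_sort :> completeNormedModType R;
  bl_sup : bl_sort -> bl_sort -> bl_sort;
  bl_inf : bl_sort -> bl_sort -> bl_sort;
  bl_supC : forall x y, bl_sup x y = bl_sup y x;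
  bl_supA : forall x y z, bl_sup x (bl_sup y z) = bl_sup (bl_sup x y) z;
  bl_supxx : forall x, bl_sup x x = x;
  bl_infE : forall x y, bl_inf x y = - bl_sup (- x) (- y);
  bl_sup_absorb : forall x y, bl_sup x (bl_inf x y) = x;
  bl_supD : forall x y z, bl_sup (x + z) (y + z) = bl_sup x y + z;
  bl_supZ : forall (a : R) x y, 0 <= a -> bl_sup (a *: x) (a *: y) = a *: bl_sup x y;
  bl_norm_mono : forall x y,
      bl_sup (bl_sup x (- x)) (bl_sup y (- y)) = bl_sup y (- y) -> `|x| <= `|y|
}.

Section Defs.
Variable R : realType.

Definition linear_on (E : normedModType R) (Y : lmodType R) (P : set E)
  (T : E -> Y) := forall (a : R) x y, P x -> P y -> T (a *: x + y) = a *: T x + T y.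

Definition bounded_on (E Y : normedModType R) (P : set E) (T : E -> Y) :=
  exists M : R, forall x, P x -> `|T x| <= M * `|x|.

Definition contraction_on (E Y : normedModType R) (P : set E) (T : E -> Y) :=
  forall x, P x -> `|T x| <= `|x|.

Definition opnorm_on (E Y : normedModType R) (P : set E) (T : E -> Y) : R :=
  sup [set `|T x| | x in [set x | P x /\ `|x| <= 1]].

Definition lin_subspace (E : normedModType R) (F : set E) :=
  F 0 /\ forall (a : R) x y, F x -> F y -> F (a *: x + y).

Definition lattice_hom (X Y : banachLattice R) (J : X -> Y) :=
  linear_on setT J /\ forall x y, J (bl_sup x y) = bl_sup (J x) (J y).

(* closure class: Y is lattice isometric to a closed sublattice of an
   l_infty-sum (+)_{g in G} X_g with all X_g in C; J is the embedding,
   written coordinatewise (J y) g. Its image is automatically a closed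
   sublattice since J is a lattice isometry and Y is complete. *)
Definition in_closure (C : banachLattice R -> Prop) (Y : banachLattice R) :=
  exists (G : Type) (X : G -> banachLattice R) (J : Y -> forall g, X g),
    (forall g, C (X g)) /\
    (forall g, lattice_hom (fun y => J y g)) /\
    (forall y : Y, has_ubound [set `|J y g| | g in [set: G]] /\
                   `|y| = sup [set `|J y g| | g in [set: G]]).

(* Lattice-linear expressions in generators from E: these represent
   elements of FVL[E] (the element [delta_x] is [LAtom x]). *)
Inductive lterm (E : Type) :=
| LAtom of E
| LZero
| LAdd of lterm E & lterm E
| LScale of R & lterm E
| LSup of lterm E & lterm E
| LInf of lterm E & lterm E.

Definition LSub E (s t : lterm E) := LAdd s (LScale (-1) t).

Fixpoint leval (E : Type) (Y : banachLattice R) (T : E -> Y) (t : lterm E) : Y :=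
  match t with
  | LAtom x => T x
  | LZero => 0
  | LAdd s u => leval T s + leval T u
  | LScale a s => a *: leval T s
  | LSup s u => bl_sup (leval T s) (leval T u)
  | LInf s u => bl_inf (leval T s) (leval T u)
  end.

Fixpoint atoms_in (E : Type) (P : set E) (t : lterm E) : Prop :=
  match t with
  | LAtom x => P x
  | LZero => True
  | LAdd s u | LSup s u | LInf s u => atoms_in P s /\ atoms_in P u
  | LScale _ s => atoms_in P s
  end.

(* rho_C on FVL[P], where P is a (closed) subspace of E (P = setT for E
   itself): sup over Y in C and linear contractions T : P -> Y. *)
Definition rhoC (C : banachLattice R -> Prop) (E : normedModType R) (P : set E)
  (t : lterm E) : R :=
  sup [set r | exists Y : banachLattice R, C Y /\
         exists T : E -> Y, linear_on P T /\ contraction_on P T /\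
           r = `|leval T t|].

(* FBL^C[P] = completion of (FVL[P], rho_C): elements are rho_C-Cauchy
   sequences of elements of FVL[P], identified when their difference
   tends to 0. *)
Definition fbl_elt (C : banachLattice R -> Prop) (E : normedModType R) (P : set E)
  (u : nat -> lterm E) :=
  (forall n, atoms_in P (u n)) /\
  forall e : R, 0 < e -> exists N, forall n m, (N <= n)%N -> (N <= m)%N ->
      rhoC C P (LSub (u n) (u m)) < e.

Definition fbl_eq (C : banachLattice R -> Prop) (E : normedModType R) (P : set E)
  (u v : nat -> lterm E) :=
  (fun n => rhoC C P (LSub (u n) (v n))) @ \oo --> (0 : R).

Definition fbl_norm (C : banachLattice R -> Prop) (E : normedModType R) (P : set E)
  (u : nat -> lterm E) : R :=
  limn (fun n => rhoC C P (u n)).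

Definition ext_property (C : banachLattice R -> Prop) (E : normedModType R)
  (F : set E) :=
  forall X : banachLattice R, in_closure C X ->
  forall T : E -> X, linear_on F T -> bounded_on F T ->
  exists Tt : E -> X, linear_on setT Tt /\ bounded_on setT Tt /\
    (forall x, F x -> Tt x = T x) /\ opnorm_on setT Tt = opnorm_on F T.

(* Condition (2): iota_bar : FBL^C[F] -> FBL^C[E] (acting as the identity
   on representing sequences of terms, i.e. f |-> f o iota^* on FVL[F])
   is isometric, and there is a contractive lattice homomorphic projection
   P of FBL^C[E] onto iota_bar(FBL^C[F]). *)
Definition proj_property (C : banachLattice R -> Prop) (E : normedModType R)
  (F : set E) :=
  (forall w, fbl_elt C F w -> fbl_norm C setT w = fbl_norm C F w) /\
  exists P : (nat -> lterm E) -> (nat -> lterm E),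
    (forall u, fbl_elt C setT u -> fbl_elt C setT (P u)) /\
    (forall u v, fbl_elt C setT u -> fbl_elt C setT v ->
       fbl_eq C setT u v -> fbl_eq C setT (P u) (P v)) /\
    (forall (a : R) u v, fbl_elt C setT u -> fbl_elt C setT v ->
       fbl_eq C setT (P (fun n => LAdd (LScale a (u n)) (v n)))
                     (fun n => LAdd (LScale a (P u n)) (P v n))) /\
    (forall u v, fbl_elt C setT u -> fbl_elt C setT v ->
       fbl_eq C setT (P (fun n => LSup (u n) (v n)))
                     (fun n => LSup (P u n) (P v n))) /\
    (forall u, fbl_elt C setT u -> fbl_norm C setT (P u) <= fbl_norm C setT u) /\
    (forall u, fbl_elt C setT u ->
       exists w, fbl_elt C F w /\ fbl_eq C setT (P u) w) /\
    (* identity on iota_bar(FBL^C[F]) (hence onto it, and a projection) *)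
    (forall w, fbl_elt C F w -> fbl_eq C setT (P w) w).

End Defs.

(* Main.v *)
Require Import Defs.
From HB Require Import structures.
From mathcomp Require Import all_boot all_order all_algebra.
From mathcomp Require Import all_classical all_reals all_analysis.
Set Implicit Arguments. Unset Strict Implicit. Unset Printing Implicit Defensive.
Import Order.TTheory GRing.Theory Num.Theory.
Import numFieldNormedType.Exports.
Local Open Scope classical_set_scope.
Local Open Scope ring_scope.

(** After rescaling, (1) says that contractions from [F] into members of the
    closure class extend to contractions on [E].

    (1) => (2): FBL^C[F] itself belongs to the closure class.  It is realised as
    the uniform closure of FVL[F] in an l_infty-sum of members of [C], taken over
    a family of contractions that norms every lattice-linear term.  The canonical
    map phi : F -> FBL^C[F] thus extends to a contraction S on [E], and the
    lattice homomorphism FBL^C[E] -> FBL^C[F] induced by S is the projection.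
    Extending contractions from [F] into members of [C] shows that the two
    seminorms rho_C agree on FVL[F].

    (2) => (1): for a contraction T : F -> X, compose x |-> delta_x with the
    projection and with the extension of T to FBL^C[F]. *)

(** * Banach lattices *)

Section BanachLatticeTheory.
Context {R : realType} {X : banachLattice R}.
Implicit Types x y z : X.

Definition bl_le x y := bl_sup x y = y.
Definition bl_abs x := bl_sup x (- x).

Lemma bl_le_trans y x z : bl_le x y -> bl_le y z -> bl_le x z.
Proof. by rewrite /bl_le => xy yz; rewrite -yz bl_supA xy. Qed.

Lemma bl_leD2r z x y : bl_le x y -> bl_le (x + z) (y + z).
Proof. by rewrite /bl_le bl_supD => ->. Qed.

Lemma bl_leD2l z x y : bl_le x y -> bl_le (z + x) (z + y).
Proof. by rewrite ![z + _]addrC; exact: bl_leD2r. Qed.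

Lemma bl_le_supl x y : bl_le x (bl_sup x y).
Proof. by rewrite /bl_le bl_supA bl_supxx. Qed.

Lemma bl_le_supr x y : bl_le y (bl_sup x y).
Proof. by rewrite bl_supC; exact: bl_le_supl. Qed.

Lemma bl_sup_le x y z : bl_le x z -> bl_le y z -> bl_le (bl_sup x y) z.
Proof. by rewrite /bl_le -bl_supA => xz ->. Qed.

(** Adding x <= |x| and -x <= |x| gives 0 <= |x| + |x|; positive homogeneity of the supremum then
    allows halving. *)
Lemma bl_abs_ge0 x : bl_le 0 (bl_abs x).
Proof.
have := bl_le_trans (bl_leD2r (- x) (bl_le_supl x (- x)))
                    (bl_leD2l (bl_abs x) (bl_le_supr x (- x))).
rewrite subrr -/(bl_abs x) /bl_le => h.
have half : 2^-1 *: (bl_abs x + bl_abs x) = bl_abs x.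
  by rewrite scalerDr -scalerDl -[2^-1]mul1r -splitr scale1r.
have := bl_supZ 0 (bl_abs x + bl_abs x) (_ : 0 <= 2^-1 :> R).
by rewrite h scaler0 half; apply; rewrite invr_ge0.
Qed.

Lemma norm_bl_le x y :
  bl_le x (bl_abs y) -> bl_le (- x) (bl_abs y) -> `|x| <= `|y|.
Proof. by move=> h1 h2; apply: bl_norm_mono; exact: bl_sup_le. Qed.

(** Birkhoff's inequality. If a - b <= |d|, then both a and y lie below |d| + sup(b, y): the first
    since b <= sup(b, y), the second since 0 <= |d|. Applying this in both orders bounds the
    difference of suprema by |x - x'|, and the norm is monotone. *)
Lemma norm_bl_supBl x x' y : `|bl_sup x y - bl_sup x' y| <= `|x - x'|.
Proof.
have le1 a b d : bl_le (a - b) (bl_abs d) ->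
    bl_le (bl_sup a y - bl_sup b y) (bl_abs d).
  move=> h; rewrite -[X in bl_le _ X](addrK (bl_sup b y)).
  apply: bl_leD2r; apply: bl_sup_le.
    have := bl_leD2r b h; rewrite subrK => /bl_le_trans; apply.
    exact/bl_leD2l/bl_le_supl.
  apply: (bl_le_trans (bl_le_supr b y)).
  by have := bl_leD2r (bl_sup b y) (bl_abs_ge0 d); rewrite add0r.
apply: norm_bl_le; first by apply: le1; exact: bl_le_supl.
by rewrite opprB; apply: le1; rewrite -[x' - x]opprB; exact: bl_le_supr.
Qed.

Lemma norm_bl_supB x x' y y' :
  `|bl_sup x y - bl_sup x' y'| <= `|x - x'| + `|y - y'|.
Proof.
apply: (le_trans (ler_distD (bl_sup x' y) _ _)).
by rewrite lerD ?norm_bl_supBl// ![bl_sup x' _]bl_supC norm_bl_supBl.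
Qed.

Lemma norm_bl_sup x y : `|bl_sup x y| <= `|x| + `|y|.
Proof. by have := norm_bl_supB x 0 y 0; rewrite bl_supxx !subr0. Qed.

Lemma norm_bl_inf x y : `|bl_inf x y| <= `|x| + `|y|.
Proof. by rewrite bl_infE normrN (le_trans (norm_bl_sup _ _))// !normrN. Qed.

End BanachLatticeTheory.

(** * Closed sublattices of l_infty-sums as Banach lattices *)

Section LinfSublattice.
Context {R : realType} {G : Type} {Y : G -> banachLattice R}.

(** The ambient l_infty-sum is never constructed: boundedness of each family is a field, and
    closedness means closedness under uniform approximation. Infima need no field, being -sup(-x,
    -y). *)
Record linf_sublattice := LinfSublattice {
  ls_set :> (forall g, Y g) -> Prop;
  ls_lin : forall (a : R) x y, ls_set x -> ls_set y ->
    ls_set (fun g => a *: x g + y g);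
  ls_zero : ls_set (fun=> 0);
  ls_sup : forall x y, ls_set x -> ls_set y ->
    ls_set (fun g => bl_sup (x g) (y g));
  ls_bounded : forall x, ls_set x -> exists M : R, forall g, `|x g| <= M;
  ls_closed : forall x,
    (forall e : R, 0 < e -> exists2 y, ls_set y & forall g, `|x g - y g| <= e) ->
    ls_set x }.

Record ls_type (S : linf_sublattice) := LsType {
  ls_val :> forall g, Y g;
  ls_valP : S ls_val }.

Variable S : linf_sublattice.
Local Notation V := (ls_type S).
Implicit Types x y z : V.

Lemma ls_ext x y : (forall g, x g = y g) -> x = y.
Proof.
case: x y => [x xS] [y yS] /= xy.
have E : x = y by exact: functional_extensionality_dep.
by case: _ / E in yS xy *; congr LsType; exact: Prop_irrelevance.
Qed.

HB.instance Definition _ := gen_eqMixin V.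
HB.instance Definition _ := gen_choiceMixin V.

Fact ls_add_subproof x y : S (fun g => x g + y g).
Proof.
suff -> : (fun g => x g + y g) = (fun g => 1 *: x g + y g).
  by apply: ls_lin; exact: ls_valP.
by apply: functional_extensionality_dep => g; rewrite scale1r.
Qed.

Fact ls_scale_subproof (a : R) x : S (fun g => a *: x g).
Proof.
suff -> : (fun g => a *: x g) = (fun g => a *: x g + 0).
  by apply: ls_lin; [exact: ls_valP|exact: ls_zero].
by apply: functional_extensionality_dep => g; rewrite addr0.
Qed.

Fact ls_opp_subproof x : S (fun g => - x g).
Proof.
suff -> : (fun g => - x g) = (fun g => (-1 : R) *: x g).
  exact: ls_scale_subproof.
by apply: functional_extensionality_dep => g; rewrite scaleN1r.
Qed.

Definition ls_0 : V := LsType (ls_zero S).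
Definition ls_add x y : V := LsType (ls_add_subproof x y).
Definition ls_opp x : V := LsType (ls_opp_subproof x).
Definition ls_scale a x : V := LsType (ls_scale_subproof a x).

Fact ls_addA : associative ls_add.
Proof. by move=> x y z; apply: ls_ext => g /=; rewrite addrA. Qed.
Fact ls_addC : commutative ls_add.
Proof. by move=> x y; apply: ls_ext => g /=; rewrite addrC. Qed.
Fact ls_add0 : left_id ls_0 ls_add.
Proof. by move=> x; apply: ls_ext => g /=; rewrite add0r. Qed.
Fact ls_addN : left_inverse ls_0 ls_opp ls_add.
Proof. by move=> x; apply: ls_ext => g /=; rewrite addNr. Qed.
HB.instance Definition _ :=
  GRing.isZmodule.Build V ls_addA ls_addC ls_add0 ls_addN.

Fact ls_scaleA a b x : ls_scale a (ls_scale b x) = ls_scale (a * b) x.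
Proof. by apply: ls_ext => g /=; rewrite scalerA. Qed.
Fact ls_scale1 : left_id 1 ls_scale.
Proof. by move=> x; apply: ls_ext => g /=; rewrite scale1r. Qed.
Fact ls_scaleDr : right_distributive ls_scale +%R.
Proof. by move=> a x y; apply: ls_ext => g /=; rewrite scalerDr. Qed.
Fact ls_scaleDl x : {morph ls_scale^~ x : a b / a + b}.
Proof. by move=> a b; apply: ls_ext => g /=; rewrite scalerDl. Qed.
HB.instance Definition _ :=
  GRing.Zmodule_isLmodule.Build R V ls_scaleA ls_scale1 ls_scaleDr ls_scaleDl.

Definition ls_norm x : R := sup [set `|x g| | g in [set: G]].

Lemma ls_has_ubound x : has_ubound [set `|x g| | g in [set: G]].
Proof.
have [M xM] := ls_bounded (ls_valP x).
by exists M => _ [g _ <-]; exact: xM.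
Qed.

Lemma ls_norm_ge x g : `|x g| <= ls_norm x.
Proof. by apply: ub_le_sup; [exact: ls_has_ubound|exists g]. Qed.

(* [0 <= c] accounts for an empty [G], where the norm is [sup set0 = 0]. *)
Lemma ls_norm_le x c : 0 <= c -> (forall g, `|x g| <= c) -> ls_norm x <= c.
Proof.
move=> c0 xc; have [[g]|G0] := pselect (inhabited G).
  by apply: ge_sup; [exists `|x g|, g|move=> _ [h _ <-]].
rewrite /ls_norm (_ : [set: G] = set0) ?image_set0 ?sup0//.
by apply/seteqP; split=> // g; case: G0.
Qed.

Lemma ls_norm_ge0 x : 0 <= ls_norm x.
Proof.
have [[g]|G0] := pselect (inhabited G).
  exact: le_trans (normr_ge0 (x g)) (ls_norm_ge x g).
rewrite /ls_norm (_ : [set: G] = set0) ?image_set0 ?sup0//.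
by apply/seteqP; split=> // g; case: G0.
Qed.

Fact ls_normD x y : ls_norm (x + y) <= ls_norm x + ls_norm y.
Proof.
apply: ls_norm_le => [|g]; first by rewrite addr_ge0 ?ls_norm_ge0.
by rewrite (le_trans (ler_normD _ _))// lerD ?ls_norm_ge.
Qed.

Fact ls_normZ (a : R) x : ls_norm (a *: x) = `|a| * ls_norm x.
Proof.
have le1 (b : R) z : ls_norm (b *: z) <= `|b| * ls_norm z.
  apply: ls_norm_le => [|g]; first by rewrite mulr_ge0 ?ls_norm_ge0.
  by rewrite normrZ ler_wpM2l ?ls_norm_ge.
apply/eqP; rewrite eq_le le1/=.
have [->|a0] := eqVneq a 0; first by rewrite normr0 mul0r ls_norm_ge0.
(* The reverse inequality is the first one for the scalar [a^-1] and the vector [a *: x]. *)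
have := le1 a^-1 (a *: x).
by rewrite scalerA mulVf// scale1r normfV ler_pdivlMl ?normr_gt0.
Qed.

Fact ls_norm0_eq0 x : ls_norm x = 0 -> x = 0.
Proof.
move=> x0; apply: ls_ext => g; apply/eqP; rewrite -normr_le0 -x0.
exact: ls_norm_ge.
Qed.

HB.instance Definition _ :=
  Lmodule_isNormed.Build R V ls_normD ls_normZ ls_norm0_eq0.

(** A Cauchy filter converges in each coordinate because every [Y g] is complete. The Cauchy
    estimates do not depend on [g], so they survive the passage to the limit ([lA]); the limit
    family is thus uniformly approximated by members of [S], and [ls_closed] puts it in [S]. *)
Fact ls_complete (A : set_system V) : ProperFilter A -> cauchy A -> cvg A.
Proof.
move=> PA /cauchyP cA.
have cAg g : cvg ((fun x : V => x g) @ A).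
  apply: cauchy_cvg; apply/cauchyP => e e0.
  have [x Ax] := cA _ e0; exists (x g).
  rewrite /= nbhs_filterE; apply: filterS Ax => y.
  rewrite -!ball_normE /= => /(le_lt_trans _); apply.
  exact: (ls_norm_ge (x - y)).
pose l g : Y g := lim ((fun x : V => x g) @ A).
have lA e x : A (ball x e) -> forall g, `|l g - x g| <= e.
  move=> Ax g; apply/ler_addgt0Pr => d d0.
  have lg : (fun y : V => y g) @ A --> l g by exact: cAg.
  have [y [Axy lyd]] := filter_ex (filterI Ax (cvgr_dist_le _ _ lg _ d0)).
  rewrite [e + d]addrC (le_trans (ler_distD (y g) _ _))// lerD// distrC.
  move: Axy; rewrite -ball_normE /= => /ltW; apply: le_trans.
  exact: (ls_norm_ge (x - y)).
have Sl : S l.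
  apply: ls_closed => e e0; have [x Ax] := cA _ e0.
  by exists x; [exact: ls_valP|exact: lA].
apply/cvg_ex; exists (LsType Sl); apply/cvgrPdist_le => e e0.
have e20 : 0 < e / 2 by rewrite divr_gt0.
have [x Ax] := cA _ e20.
have lx : `|LsType Sl - x| <= e / 2.
  by apply: ls_norm_le; [exact: ltW|exact: lA].
apply: filterS Ax => y yx.
rewrite [e]splitr (le_trans (ler_distD x _ _))// lerD//.
by move: yx; rewrite -ball_normE /= => /ltW.
Qed.

HB.instance Definition _ := Uniform_isComplete.Build V ls_complete.

Definition ls_vsup x y : V := LsType (ls_sup (ls_valP x) (ls_valP y)).
Definition ls_vinf x y : V := - ls_vsup (- x) (- y).

Fact ls_vsupC x y : ls_vsup x y = ls_vsup y x.
Proof. by apply: ls_ext => g /=; rewrite bl_supC. Qed.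
Fact ls_vsupA x y z : ls_vsup x (ls_vsup y z) = ls_vsup (ls_vsup x y) z.
Proof. by apply: ls_ext => g /=; rewrite bl_supA. Qed.
Fact ls_vsupxx x : ls_vsup x x = x.
Proof. by apply: ls_ext => g /=; rewrite bl_supxx. Qed.
Fact ls_vsup_absorb x y : ls_vsup x (ls_vinf x y) = x.
Proof. by apply: ls_ext => g /=; rewrite -bl_infE bl_sup_absorb. Qed.
Fact ls_vsupD x y z : ls_vsup (x + z) (y + z) = ls_vsup x y + z.
Proof. by apply: ls_ext => g /=; rewrite bl_supD. Qed.
Fact ls_vsupZ (a : R) x y :
  0 <= a -> ls_vsup (a *: x) (a *: y) = a *: ls_vsup x y.
Proof. by move=> a0; apply: ls_ext => g /=; rewrite bl_supZ. Qed.
Fact ls_vnorm_mono x y :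
  ls_vsup (ls_vsup x (- x)) (ls_vsup y (- y)) = ls_vsup y (- y) -> `|x| <= `|y|.
Proof.
move=> xy; apply: ls_norm_le => [|g]; first exact: ls_norm_ge0.
apply: le_trans (ls_norm_ge y g); apply: bl_norm_mono.
by have := congr1 (fun z : V => z g) xy.
Qed.

Definition ls_lattice : banachLattice R :=
  @BanachLattice R V ls_vsup ls_vinf ls_vsupC ls_vsupA ls_vsupxx
    (fun _ _ => erefl) ls_vsup_absorb ls_vsupD ls_vsupZ ls_vnorm_mono.

Lemma ls_lattice_hom g : lattice_hom (fun x : ls_lattice => (x : V) g).
Proof. by []. Qed.

Lemma ls_lattice_in_closure (C : banachLattice R -> Prop) :
  (forall g, C (Y g)) -> in_closure C ls_lattice.
Proof.
move=> CY; exists G, Y, (fun (y : ls_lattice) g => (y : V) g); split=> //; split.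
  exact: ls_lattice_hom.
by move=> y; split; [exact: ls_has_ubound|].
Qed.

End LinfSublattice.

(** * Operators and lattice-linear terms *)

Section LinearOn.
Context {R : realType} {E Y : normedModType R} {P : set E}.
Hypothesis P_sub : lin_subspace P.

Lemma lin_subspaceZ (a : R) x : P x -> P (a *: x).
Proof.
by move=> Px; rewrite -[_ *: _]addr0; apply: P_sub.2 => //; exact: P_sub.1.
Qed.

Lemma linear_on0 (T : E -> Y) : linear_on P T -> T 0 = 0.
Proof.
move=> /(_ 1 0 0 P_sub.1 P_sub.1); rewrite !scale1r addr0 => /eqP.
by rewrite addrC -subr_eq subrr => /eqP.
Qed.

Lemma linear_onZ (T : E -> Y) (a : R) x :
  linear_on P T -> P x -> T (a *: x) = a *: T x.
Proof.
by move=> linT Px; rewrite -[a *: x]addr0 linT ?linear_on0 ?addr0//; exact: P_sub.1.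
Qed.

Lemma opnorm_on_le (T : E -> Y) (M : R) : 0 <= M ->
  (forall x, P x -> `|T x| <= M * `|x|) -> opnorm_on P T <= M.
Proof.
move=> M0 TM; apply: ge_sup.
  by exists `|T 0|, 0 => //=; split; [exact: P_sub.1|rewrite normr0].
move=> _ [x [Px x1] <-]; apply: (le_trans (TM x Px)).
by rewrite -[leRHS]mulr1 ler_wpM2l.
Qed.

Lemma opnorm_on_has_ubound (T : E -> Y) : bounded_on P T ->
  has_ubound [set `|T x| | x in [set x | P x /\ `|x| <= 1]].
Proof.
move=> [M TM]; exists `|M| => _ [y [Py y1] <-]; apply: (le_trans (TM y Py)).
rewrite (le_trans (ler_norm _))// normrM normr_id -[leRHS]mulr1.
by rewrite ler_wpM2l.
Qed.

Lemma opnorm_onP (T : E -> Y) : linear_on P T -> bounded_on P T ->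
  forall x, P x -> `|T x| <= opnorm_on P T * `|x|.
Proof.
move=> linT bT x Px.
have [->|x0] := eqVneq x 0; first by rewrite linear_on0// !normr0 mulr0.
rewrite -ler_pdivrMr ?normr_gt0//.
have -> : `|T x| / `|x| = `|T (`|x|^-1 *: x)|.
  by rewrite linear_onZ// normrZ normfV normr_id mulrC.
apply: ub_le_sup; first exact: opnorm_on_has_ubound.
exists (`|x|^-1 *: x) => //=; split; first exact: lin_subspaceZ.
by rewrite normrZ normfV normr_id mulVf ?normr_eq0.
Qed.

Lemma opnorm_on_ge0 (T : E -> Y) : linear_on P T -> bounded_on P T ->
  0 <= opnorm_on P T.
Proof.
move=> linT bT; apply: ub_le_sup; first exact: opnorm_on_has_ubound.
exists 0; last by rewrite linear_on0// normr0.
by split; [exact: P_sub.1|rewrite normr0].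
Qed.

End LinearOn.

Section Terms.
Context {R : realType} {E : Type}.
Implicit Types (t : lterm R E) (P : set E).

Lemma atoms_inT t : atoms_in setT t.
Proof. by elim: t => //= *; split. Qed.

Lemma eq_leval_in P (Y : banachLattice R) (T T' : E -> Y) t :
  (forall x, P x -> T x = T' x) -> atoms_in P t -> leval T t = leval T' t.
Proof.
move=> TT'; elim: t => //=.
- by move=> s IHs u IHu [/IHs -> /IHu ->].
- by move=> a s IHs /IHs ->.
- by move=> s IHs u IHu [/IHs -> /IHu ->].
- by move=> s IHs u IHu [/IHs -> /IHu ->].
Qed.

(** The functoriality of the extension to FVL: composing the extension of T with J gives the
    extension of J T. Infima are preserved because they are expressed by suprema and negation. *)
Lemma lattice_hom_leval (X Y : banachLattice R) (J : X -> Y) (T : E -> X) t :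
  lattice_hom J -> J (leval T t) = leval (J \o T) t.
Proof.
move=> [linJ supJ].
have subT : lin_subspace [set: X] by [].
have JZ a x : J (a *: x) = a *: J x by rewrite (linear_onZ subT).
have JN x : J (- x) = - J x by rewrite -[- x]scaleN1r JZ scaleN1r.
have JD x y : J (x + y) = J x + J y by have := linJ 1 x y I I; rewrite !scale1r.
elim: t => [x||s IHs u IHu|a s IHs|s IHs u IHu|s IHs u IHu] //=.
- by rewrite (linear_on0 subT).
- by rewrite JD IHs IHu.
- by rewrite JZ IHs.
- by rewrite supJ IHs IHu.
- by rewrite !bl_infE JN supJ !JN IHs IHu.
Qed.

End Terms.

(** * The seminorm rho_C on lattice-linear terms *)

Section RhoC.
Context {R : realType} {E : normedModType R}.

(** A bound common to all contractions; it makes the set defining [rhoC] bounded, so that its [sup]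
    is a genuine supremum and not a default value. *)
Fixpoint lterm_bound (t : lterm R E) : R :=
  match t with
  | LAtom x => `|x|
  | LZero => 0
  | LAdd s u | LSup s u | LInf s u => lterm_bound s + lterm_bound u
  | LScale a s => `|a| * lterm_bound s
  end.

Variables (C : banachLattice R -> Prop) (P : set E).
Hypothesis C_ex : exists X, C X.
Implicit Types s t u : lterm R E.

Lemma norm_leval_le (Y : banachLattice R) (T : E -> Y) t :
  contraction_on P T -> atoms_in P t -> `|leval T t| <= lterm_bound t.
Proof.
move=> cT; elim: t => [x||s IHs u IHu|a s IHs|s IHs u IHu|s IHs u IHu] /=.
- exact: cT.
- by rewrite normr0.
- by move=> [/IHs hs /IHu hu]; rewrite (le_trans (ler_normD _ _))// lerD.
- by move=> /IHs hs; rewrite normrZ ler_wpM2l.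
- by move=> [/IHs hs /IHu hu]; rewrite (le_trans (norm_bl_sup _ _))// lerD.
- by move=> [/IHs hs /IHu hu]; rewrite (le_trans (norm_bl_inf _ _))// lerD.
Qed.

Lemma rhoC_has_sup t : atoms_in P t ->
  has_sup [set r | exists Y : banachLattice R, C Y /\
         exists T : E -> Y, linear_on P T /\ contraction_on P T /\
           r = `|leval T t|].
Proof.
move=> Pt; split.
  (* The zero operator into a member of [C] shows that the set is non-empty. *)
  have [X CX] := C_ex; exists `|leval (fun _ : E => 0 : X) t|, X; split=> //.
  exists (fun=> 0); split; first by move=> *; rewrite scaler0 addr0.
  by split=> // x _; rewrite normr0.
exists (lterm_bound t) => _ [Y [_ [T [_ [cT ->]]]]].
exact: norm_leval_le.
Qed.

Lemma rhoC_ge t (Y : banachLattice R) (T : E -> Y) : atoms_in P t ->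
  C Y -> linear_on P T -> contraction_on P T -> `|leval T t| <= rhoC C P t.
Proof.
move=> Pt CY lT cT; apply: ub_le_sup; first exact: (rhoC_has_sup Pt).2.
by exists Y; split=> //; exists T.
Qed.

Lemma rhoC_le t c : atoms_in P t ->
  (forall (Y : banachLattice R) (T : E -> Y), C Y ->
    linear_on P T -> contraction_on P T -> `|leval T t| <= c) ->
  rhoC C P t <= c.
Proof.
move=> Pt tc; apply: ge_sup; first exact: (rhoC_has_sup Pt).1.
by move=> _ [Y [CY [T [lT [cT ->]]]]]; exact: tc.
Qed.

Lemma rhoC_ge0 t : atoms_in P t -> 0 <= rhoC C P t.
Proof.
move=> Pt; have [X CX] := C_ex.
apply: (le_trans (normr_ge0 (leval (fun _ : E => 0 : X) t))).
apply: rhoC_ge => //; first by move=> *; rewrite scaler0 addr0.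
by move=> x _; rewrite normr0.
Qed.

(** Triangle-type inequalities for [rhoC] are obtained by checking them under each single
    operator. *)
Lemma rhoC_le_add s1 s2 t : atoms_in P s1 -> atoms_in P s2 -> atoms_in P t ->
  (forall (Y : banachLattice R) (T : E -> Y), linear_on P T ->
     `|leval T t| <= `|leval T s1| + `|leval T s2|) ->
  rhoC C P t <= rhoC C P s1 + rhoC C P s2.
Proof.
move=> Ps1 Ps2 Pt h; apply: rhoC_le => // Y T CY lT cT.
by rewrite (le_trans (h _ _ lT))// lerD ?rhoC_ge.
Qed.

Lemma atoms_in_sub s t : atoms_in P s -> atoms_in P t -> atoms_in P (LSub s t).
Proof. by []. Qed.

Lemma leval_sub (Y : banachLattice R) (T : E -> Y) s t :
  leval T (LSub s t) = leval T s - leval T t.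
Proof. by rewrite /= scaleN1r. Qed.

Lemma rhoC_subC s t : atoms_in P s -> atoms_in P t ->
  rhoC C P (LSub s t) = rhoC C P (LSub t s).
Proof.
move=> Ps Pt; rewrite /rhoC; congr (sup _); apply/seteqP.
by split=> r [Y [CY [T [lT [cT ->]]]]]; exists Y; split=> //; exists T;
  do 2 split=> //; rewrite !leval_sub distrC.
Qed.

Lemma rhoC_subxx s : atoms_in P s -> rhoC C P (LSub s s) = 0.
Proof.
move=> Ps; apply/eqP; rewrite eq_le rhoC_ge0// andbT.
by apply: rhoC_le => // Y T *; rewrite leval_sub subrr normr0.
Qed.

Lemma rhoC_dist s t : atoms_in P s -> atoms_in P t ->
  `|rhoC C P s - rhoC C P t| <= rhoC C P (LSub s t).
Proof.
have le1 u v : atoms_in P u -> atoms_in P v ->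
    rhoC C P u - rhoC C P v <= rhoC C P (LSub u v).
  move=> Pu Pv; rewrite lerBlDr; apply: rhoC_le_add => // Y T lT.
  by rewrite leval_sub -{1}(subrK (leval T v) (leval T u)) ler_normD.
move=> Ps Pt; rewrite ler_norml le1// andbT lerNl opprB rhoC_subC//.
exact: le1.
Qed.

Lemma rhoC_triangle s t u : atoms_in P s -> atoms_in P t -> atoms_in P u ->
  rhoC C P (LSub s u) <= rhoC C P (LSub s t) + rhoC C P (LSub t u).
Proof.
by move=> *; apply: rhoC_le_add => // Y T lT; rewrite !leval_sub ler_distD.
Qed.

(** Testing against the closure class gives nothing larger: each coordinate of the
    l_infty-embedding, composed with [T], is a contraction into a member of [C], and the norm in [Y]
    is the supremum over the coordinates. *)
Lemma rhoC_ge_closure t (Y : banachLattice R) (T : E -> Y) : atoms_in P t ->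
  in_closure C Y -> linear_on P T -> contraction_on P T ->
  `|leval T t| <= rhoC C P t.
Proof.
move=> Pt [G [X [J [CX [hJ nJ]]]]] lT cT.
(* Over an empty index type the norm is [sup set0], which is 0. *)
rewrite (nJ _).2; have [[g0]|G0] := pselect (inhabited G); last first.
  rewrite (_ : [set: G] = set0) ?image_set0 ?sup0 ?rhoC_ge0//.
  by apply/seteqP; split=> // g; case: G0.
apply: ge_sup; first by exists `|J (leval T t) g0|, g0.
move=> _ [g _ <-]; rewrite (lattice_hom_leval T t (hJ g)).
apply: rhoC_ge => //.
  by move=> a x y Px Py /=; rewrite lT// (hJ g).1.
move=> x Px /=; apply: le_trans (cT x Px); rewrite (nJ (T x)).2.
by apply: ub_le_sup; [exact: (nJ _).1|exists g].
Qed.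

End RhoC.

(** * Cauchy sequences of terms as elements of FBL *)

Lemma cauchy_seq_cvg {R : realType} {V : completeNormedModType R} (u : nat -> V) :
  (forall e : R, 0 < e -> exists N, forall n m, (N <= n)%N -> (N <= m)%N ->
     `|u n - u m| < e) -> cvgn u.
Proof.
move=> cu; apply: cauchy_cvg; apply/cauchyP => e e0.
have [N uN] := cu _ e0; exists (u N); exists N => // n /= Nn.
by rewrite -ball_normE /=; exact: uN.
Qed.

Lemma in_closure_self {R : realType} (C : banachLattice R -> Prop) Y :
  C Y -> in_closure C Y.
Proof.
move=> CY; exists unit, (fun=> Y), (fun y _ => y); split=> //; split=> // y.
have -> : [set `|y| | _ in [set: unit]] = [set `|y|].
  by apply/seteqP; split=> [_ [_ _ <-]//|_ ->]; exists tt.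
by split; [exists `|y| => _ ->|rewrite sup1].
Qed.

Section FBL.
Context {R : realType} {E : normedModType R}.
Variables (C : banachLattice R -> Prop) (P : set E).
Hypothesis C_ex : exists X, C X.
Implicit Types u v w : nat -> lterm R E.

Lemma fbl_elt_cst t : atoms_in P t -> fbl_elt C P (fun=> t).
Proof.
by move=> Pt; split=> // e e0; exists 0%N => n m _ _; rewrite rhoC_subxx.
Qed.

Lemma fbl_eqP u v : (forall n, atoms_in P (u n)) -> (forall n, atoms_in P (v n)) ->
  fbl_eq C P u v <->
  forall e, 0 < e -> \forall n \near \oo, rhoC C P (LSub (u n) (v n)) <= e.
Proof.
move=> Pu Pv; split=> [/cvgrPdist_le uv e e0|uv].
  apply: filterS (uv e e0) => n.
  by rewrite sub0r normrN ger0_norm ?rhoC_ge0//; exact: atoms_in_sub.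
apply/cvgrPdist_le => e e0; apply: filterS (uv e e0) => n.
by rewrite sub0r normrN ger0_norm ?rhoC_ge0//; exact: atoms_in_sub.
Qed.

Lemma fbl_eq_sym u v : (forall n, atoms_in P (u n)) -> (forall n, atoms_in P (v n)) ->
  fbl_eq C P u v -> fbl_eq C P v u.
Proof.
move=> Pu Pv /(fbl_eqP Pu Pv) uv; apply/(fbl_eqP Pv Pu) => e e0.
by apply: filterS (uv e e0) => n; rewrite rhoC_subC.
Qed.

Lemma fbl_eq_trans v u w : (forall n, atoms_in P (u n)) ->
  (forall n, atoms_in P (v n)) -> (forall n, atoms_in P (w n)) ->
  fbl_eq C P u v -> fbl_eq C P v w -> fbl_eq C P u w.
Proof.
move=> Pu Pv Pw /(fbl_eqP Pu Pv) uv /(fbl_eqP Pv Pw) vw.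
apply/(fbl_eqP Pu Pw) => e e0.
have e20 : 0 < e / 2 by rewrite divr_gt0.
near=> n; rewrite (le_trans (rhoC_triangle C_ex (Pu n) (Pv n) (Pw n)))//.
rewrite [e]splitr lerD//; near: n; [exact: uv|exact: vw].
Unshelve. all: by end_near. Qed.

(** By [rhoC_dist], the seminorms along a Cauchy sequence of terms form a Cauchy sequence of
    reals. *)
Lemma fbl_norm_cvg u : fbl_elt C P u ->
  (fun n => rhoC C P (u n)) @ \oo --> fbl_norm C P u.
Proof.
move=> [Pu cu]; apply: (@cauchy_seq_cvg R R^o) => e e0.
have [N uN] := cu e e0; exists N => n m Nn Nm.
exact: le_lt_trans (rhoC_dist C_ex (Pu n) (Pu m)) (uN _ _ Nn Nm).
Qed.

Lemma fbl_eq_norm u v : fbl_elt C P u -> fbl_elt C P v ->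
  fbl_eq C P u v -> fbl_norm C P u = fbl_norm C P v.
Proof.
move=> cu cv /(fbl_eqP cu.1 cv.1) uv; apply: cvg_lim => //.
have /cvgrPdist_le vl := fbl_norm_cvg cv.
apply/cvgrPdist_le => e e0.
have e20 : 0 < e / 2 by rewrite divr_gt0.
near=> n; rewrite [e]splitr (le_trans (ler_distD (rhoC C P (v n)) _ _))// lerD//.
  by near: n; exact: vl.
rewrite distrC (le_trans (rhoC_dist C_ex (cu.1 n) (cv.1 n)))//.
by near: n; exact: uv.
Unshelve. all: by end_near. Qed.

Section Eval.
Variables (X : banachLattice R) (T : E -> X).
Hypotheses (CX : in_closure C X) (lT : linear_on P T) (cT : contraction_on P T).

(** The limit is the value at [u] of the extension of [T] to FBL^C[P]. The next two lemmas say that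
    this value depends only on the class of [u] and that the extension is contractive. *)
Lemma fbl_leval_cvg u : fbl_elt C P u ->
  (fun n => leval T (u n)) @ \oo --> limn (fun n => leval T (u n)).
Proof.
move=> [Pu cu]; apply: cauchy_seq_cvg => e e0.
have [N uN] := cu e e0; exists N => n m Nn Nm.
rewrite -leval_sub (le_lt_trans _ (uN _ _ Nn Nm))//.
by apply: rhoC_ge_closure => //; exact: atoms_in_sub.
Qed.

Lemma fbl_eq_leval u v (l : X) : (forall n, atoms_in P (u n)) ->
  (forall n, atoms_in P (v n)) -> fbl_eq C P u v ->
  (fun n => leval T (u n)) @ \oo --> l -> (fun n => leval T (v n)) @ \oo --> l.
Proof.
move=> Pu Pv /(fbl_eqP Pu Pv) uv /cvgrPdist_le ul; apply/cvgrPdist_le => e e0.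
have e20 : 0 < e / 2 by rewrite divr_gt0.
near=> n; rewrite [e]splitr (le_trans (ler_distD (leval T (u n)) _ _))// lerD//.
  by near: n; exact: ul.
rewrite -leval_sub (@le_trans _ _ (rhoC C P (LSub (u n) (v n))))//.
  by apply: rhoC_ge_closure => //; exact: atoms_in_sub.
by near: n; exact: uv.
Unshelve. all: by end_near. Qed.

Lemma fbl_leval_norm u (l : X) : fbl_elt C P u ->
  (fun n => leval T (u n)) @ \oo --> l -> `|l| <= fbl_norm C P u.
Proof.
move=> cu /cvg_norm ul.
rewrite -(cvg_lim _ ul)//; apply: ler_lim.
- by apply/cvg_ex; exists `|l|.
- exact: fbl_norm_cvg.
- by near=> n; apply: rhoC_ge_closure => //; exact: cu.1.
Unshelve. all: by end_near. Qed.

End Eval.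
End FBL.

(** * FBL as a member of the closure class *)

Section UniformClosure.
Context {R : realType} {E : normedModType R}.
Variables (P : set E) (G : Type) (Y : G -> banachLattice R).
Variable T : forall g, E -> Y g.
Hypothesis cT : forall g, contraction_on P (T g).

(** The closure, in the l_infty-sum of the [Y g], of the image of FVL[P] under the map whose
    coordinates are the extensions of the [T g]. *)
Definition leval_closure (y : forall g, Y g) := forall e : R, 0 < e ->
  exists2 t : lterm R E, atoms_in P t & forall g, `|y g - leval (T g) t| <= e.

Fact leval_closure_lin (a : R) x y : leval_closure x -> leval_closure y ->
  leval_closure (fun g => a *: x g + y g).
Proof.
move=> Sx Sy e e0; have e20 : 0 < e / 2 by rewrite divr_gt0.
(* Dividing by [|a| + 1] instead of [|a|] covers the case a = 0. *)
have a0 : 0 < `|a| + 1 by rewrite ltr_wpDl.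
have [s Ps xs] := Sx _ (divr_gt0 e20 a0); have [t Pt yt] := Sy _ e20.
exists (LAdd (LScale a s) t) => // g /=.
rewrite opprD addrACA -scalerBr [e]splitr (le_trans (ler_normD _ _))// lerD//.
rewrite normrZ (@le_trans _ _ ((`|a| + 1) * `|x g - leval (T g) s|))//.
  by rewrite ler_wpM2r// lerDl.
by rewrite mulrC -ler_pdivlMr.
Qed.

Fact leval_closure0 : leval_closure (fun=> 0).
Proof. by move=> e e0; exists (LZero _ _) => // g /=; rewrite subrr normr0 ltW. Qed.

Fact leval_closure_sup x y : leval_closure x -> leval_closure y ->
  leval_closure (fun g => bl_sup (x g) (y g)).
Proof.
move=> Sx Sy e e0; have e20 : 0 < e / 2 by rewrite divr_gt0.
have [s Ps xs] := Sx _ e20; have [t Pt yt] := Sy _ e20.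
exists (LSup s t) => // g /=.
by rewrite [e]splitr (le_trans (norm_bl_supB _ _ _ _))// lerD.
Qed.

Fact leval_closure_bounded x : leval_closure x ->
  exists M : R, forall g, `|x g| <= M.
Proof.
move=> /(_ 1 ltr01)[t Pt xt]; exists (1 + lterm_bound t) => g.
rewrite -[x g](subrK (leval (T g) t)) (le_trans (ler_normD _ _))// lerD//.
exact: norm_leval_le (cT g) Pt.
Qed.

Fact leval_closure_closed x :
  (forall e : R, 0 < e ->
    exists2 y, leval_closure y & forall g, `|x g - y g| <= e) ->
  leval_closure x.
Proof.
move=> Sx e e0; have e20 : 0 < e / 2 by rewrite divr_gt0.
have [y Sy xy] := Sx _ e20; have [t Pt yt] := Sy _ e20.
exists t => // g.
by rewrite [e]splitr (le_trans (ler_distD (y g) _ _))// lerD.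
Qed.

Definition leval_sublattice : linf_sublattice :=
  @LinfSublattice R G Y leval_closure leval_closure_lin leval_closure0
    leval_closure_sup leval_closure_bounded leval_closure_closed.

Fact leval_closure_atom x : P x -> leval_closure (fun g => T g x).
Proof.
by move=> Px e e0; exists (LAtom _ x) => // g /=; rewrite subrr normr0 ltW.
Qed.

(* Only the values on [P] matter; elsewhere the embedding is set to 0. *)
Definition leval_embed (x : E) : ls_lattice leval_sublattice :=
  if pselect (P x) is left Px then
    @LsType _ _ _ leval_sublattice _ (leval_closure_atom Px)
  else 0.

Lemma leval_embedE x g : P x ->
  ls_val (leval_embed x : ls_type leval_sublattice) g = T g x.
Proof. by move=> Px; rewrite /leval_embed; case: pselect. Qed.

Lemma leval_leval_embed t g : atoms_in P t ->
  ls_val (leval leval_embed t : ls_type leval_sublattice) g = leval (T g) t.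
Proof.
move=> Pt.
rewrite (lattice_hom_leval _ _ (ls_lattice_hom leval_sublattice g)).
by apply: eq_leval_in Pt => x Px /=; rewrite leval_embedE.
Qed.

End UniformClosure.

Section FBLModel.
Context {R : realType} {E : normedModType R}.
Variables (C : banachLattice R -> Prop) (P : set E).
Hypotheses (C_ex : exists X, C X) (P_sub : lin_subspace P).

(* The class of all contractions into members of [C] is too large to index an
   l_infty-sum; one almost norming contraction for each term and each [e > 0]
   is enough. *)
Lemma fbl_model : exists (X : banachLattice R) (phi : E -> X),
  [/\ in_closure C X, linear_on P phi, contraction_on P phi,
      forall t, atoms_in P t -> `|leval phi t| = rhoC C P t
    & forall x (e : R), 0 < e ->
        exists2 t, atoms_in P t & `|x - leval phi t| <= e].
Proof.
have H (g : lterm R E * R) : exists p : {Y : banachLattice R & E -> Y},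
    [/\ C (projT1 p), linear_on P (projT2 p), contraction_on P (projT2 p)
      & atoms_in P g.1 -> 0 < g.2 ->
        rhoC C P g.1 - g.2 <= `|leval (projT2 p) g.1|].
  have [X0 CX0] := C_ex.
  have [[Pt e0]|nP] := pselect (atoms_in P g.1 /\ 0 < g.2).
    have [_ [Y [CY [T [lT [cT ->]]]]] rT] := sup_adherent e0 (rhoC_has_sup C_ex Pt).
    by exists (existT _ Y T); split=> //= _ _; exact: ltW.
  (* Indices with an atom outside [P] or a nonpositive tolerance receive the zero operator. *)
  exists (existT _ X0 (fun=> 0)); split=> //=.
  - by move=> *; rewrite scaler0 addr0.
  - by move=> x _; rewrite normr0.
  - by move=> ? ?; case: nP.
pose Y g := projT1 (projT1 (cid (H g))).
pose T g : E -> Y g := projT2 (projT1 (cid (H g))).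
have HT g : [/\ C (Y g), linear_on P (T g), contraction_on P (T g)
    & atoms_in P g.1 -> 0 < g.2 -> rhoC C P g.1 - g.2 <= `|leval (T g) g.1|].
  exact: projT2 (cid (H g)).
have cT g : contraction_on P (T g) by have [] := HT g.
have inX : in_closure C (ls_lattice (leval_sublattice cT)).
  by apply: ls_lattice_in_closure => g; have [] := HT g.
exists (ls_lattice (leval_sublattice cT)), (leval_embed cT).
have lphi : linear_on P (leval_embed cT).
  move=> a x y Px Py; apply: ls_ext => g /=.
  have [_ lT _ _] := HT g.
  by rewrite !leval_embedE ?lT//; exact: P_sub.2.
have cphi : contraction_on P (leval_embed cT).
  move=> x Px; apply: ls_norm_le => // g.
  by rewrite leval_embedE//; exact: (cT g).
split=> // [t Pt|x e e0].
  (* The model lies in the closure class, which gives one inequality; the coordinate indexed by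
     [(t, e)] gives the other up to [e]. *)
  apply/eqP; rewrite eq_le (rhoC_ge_closure C_ex)//=.
  apply/ler_addgt0Pr => e e0; rewrite -lerBlDr.
  have [_ _ _ /(_ Pt e0)] := HT (t, e) => /le_trans; apply => /=.
  rewrite -(leval_leval_embed cT)//; exact: ls_norm_ge.
have [t Pt xt] := ls_valP (x : ls_type (leval_sublattice cT)) _ e0.
exists t => //; apply: ls_norm_le => [|g]; first exact: ltW.
by rewrite /= leval_leval_embed.
Qed.

End FBLModel.

(** * The two conditions *)

Lemma cvg_bl_sup {R : realType} {X : banachLattice R} (u v : nat -> X) (l m : X) :
  u @ \oo --> l -> v @ \oo --> m -> (fun n => bl_sup (u n) (v n)) @ \oo --> bl_sup l m.
Proof.
move=> /cvgrPdist_le ul /cvgrPdist_le vm; apply/cvgrPdist_le => e e0.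
have e20 : 0 < e / 2 by rewrite divr_gt0.
near=> n; rewrite [e]splitr (le_trans (norm_bl_supB _ _ _ _))// lerD//; near: n.
  exact: ul.
exact: vm.
Unshelve. all: by end_near. Qed.

Section Equivalence.
Context {R : realType} {E : normedModType R}.
Variables (C : banachLattice R -> Prop) (F : set E).
Hypotheses (C_ex : exists X, C X) (F_sub : lin_subspace F).

Let T_sub : lin_subspace [set: E]. Proof. by []. Qed.

Definition contraction_ext_property := forall (X : banachLattice R) (T : E -> X),
  in_closure C X -> linear_on F T -> contraction_on F T ->
  exists S : E -> X, [/\ linear_on setT S, contraction_on setT S
    & forall x, F x -> S x = T x].

(** A norm-preserving extension of a contraction is a contraction. Conversely, divide [T] by its
    norm [M], extend, and multiply by [M]. *)
Lemma ext_property_contraction : ext_property C F <-> contraction_ext_property.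
Proof.
split=> [ext X T CX lT cT|ext X CX T lT bT].
  have bT : bounded_on F T by exists 1 => x Fx; rewrite mul1r; exact: cT.
  have [S [lS [bS [ST nS]]]] := ext X CX T lT bT.
  exists S; split=> // x _; apply: (le_trans (opnorm_onP T_sub lS bS I)).
  rewrite nS -[leRHS]mul1r ler_wpM2r// opnorm_on_le// => y Fy.
  by rewrite mul1r; exact: cT.
pose M := opnorm_on F T.
have M0 : 0 <= M by exact: opnorm_on_ge0.
have TM := opnorm_onP F_sub lT bT.
have lT' : linear_on F (fun x => M^-1 *: T x).
  by move=> a x y Fx Fy; rewrite lT// scalerDr !scalerA mulrC.
have cT' : contraction_on F (fun x => M^-1 *: T x).
  move=> x Fx; rewrite normrZ normfV (ger0_norm M0).
  have [->|Mn0] := eqVneq M 0; first by rewrite invr0 mul0r.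
  by rewrite ler_pdivrMl ?lt0r ?Mn0//; exact: TM.
have [S [lS cS ST]] := ext X _ CX lT' cT'.
have SM x : `|M *: S x| <= M * `|x|.
  by rewrite normrZ (ger0_norm M0) ler_wpM2l//; exact: cS.
have lMS : linear_on setT (fun x => M *: S x).
  by move=> a x y _ _; rewrite lS// scalerDr !scalerA mulrC.
have bMS : bounded_on setT (fun x => M *: S x) by exists M.
have MST x : F x -> M *: S x = T x.
  move=> Fx; rewrite ST// scalerA.
  (* For M = 0 the rescaled operator is zero, as [0^-1 = 0], but [T] itself then vanishes on [F]. *)
  have [M_eq0|Mn0] := eqVneq M 0; last by rewrite mulfV// scale1r.
  have := TM x Fx; rewrite -/M M_eq0 mul0r normr_le0 => /eqP ->.
  by rewrite scaler0.
(* The norm is at most [M] by [SM], and at least [M] because the operator restricts to [T] on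
   [F]. *)
exists (fun x => M *: S x); do 3 split=> //; apply/eqP; rewrite eq_le.
rewrite opnorm_on_le//=; apply: opnorm_on_le => //; first exact: opnorm_on_ge0.
by move=> x Fx; rewrite -MST//; apply: (opnorm_onP T_sub).
Qed.

(** Every contraction on [E] restricts to a contraction on [F]. *)
Lemma rhoC_sub_le t : atoms_in F t -> rhoC C setT t <= rhoC C F t.
Proof.
move=> Ft; apply: rhoC_le => //; first exact: atoms_inT.
move=> Y T CY lT cT; apply: rhoC_ge => // [a x y _ _|x _]; first exact: lT.
exact: cT.
Qed.

Lemma rhoC_sub_eq t : contraction_ext_property ->
  atoms_in F t -> rhoC C setT t = rhoC C F t.
Proof.
move=> ext Ft; apply/eqP; rewrite eq_le rhoC_sub_le//=.
apply: rhoC_le => // Y T CY lT cT.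
have [S [lS cS ST]] := ext Y T (in_closure_self CY) lT cT.
rewrite -(eq_leval_in ST Ft); apply: rhoC_ge => //; exact: atoms_inT.
Qed.

Lemma proj_property_ext : proj_property C F -> contraction_ext_property.
Proof.
move=> [iso [Q [Qelt [Qeq [Qlin [_ [Qnorm [Qrng Qid]]]]]]]] X T CX lT cT.
(* On constant sequences the isometry of FBL norms is an equality of seminorms on FVL[F]. *)
have rhoE t : atoms_in F t -> rhoC C setT t = rhoC C F t.
  move=> Ft; have := iso _ (fbl_elt_cst C_ex Ft).
  by rewrite /fbl_norm !lim_cst.
have atT u n : atoms_in setT ((u : nat -> lterm R E) n) by exact: atoms_inT.
have eltT (x : E) : fbl_elt C setT (fun=> LAtom R x) by exact: fbl_elt_cst.
have eqF u v : (forall n, atoms_in F (u n)) -> (forall n, atoms_in F (v n)) ->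
    fbl_eq C setT u v -> fbl_eq C F u v.
  move=> Fu Fv; rewrite /fbl_eq.
  suff -> : (fun n => rhoC C setT (LSub (u n) (v n))) =
            (fun n => rhoC C F (LSub (u n) (v n))) by [].
  by apply/funext => n; rewrite rhoE//; exact: atoms_in_sub.
pose d (x : E) : nat -> lterm R E := fun=> LAtom R x.
(* [w x] represents the projection of delta_x by terms over [F], so [T] can be applied to it; [S x]
   below is the resulting value. *)
pose w x := projT1 (cid (Qrng _ (eltT x))).
have [wF wQ] : (forall x, fbl_elt C F (w x)) /\
               (forall x, fbl_eq C setT (Q (d x)) (w x)).
  by split=> x; have [] := projT2 (cid (Qrng _ (eltT x))).
have wT x : fbl_elt C setT (w x).
  split=> [n|e e0]; first exact: atoms_inT.
  have [N uN] := (wF x).2 _ e0; exists N => n m Nn Nm.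
  by rewrite rhoE ?uN//; apply: atoms_in_sub; exact: (wF x).1.
pose S x := limn (fun n => leval T (w x n)).
have cvgS x : (fun n => leval T (w x n)) @ \oo --> S x.
  exact: (fbl_leval_cvg C_ex CX lT cT (wF x)).
have limS x v : (forall n, atoms_in F (v n)) -> fbl_eq C setT (w x) v ->
    (fun n => leval T (v n)) @ \oo --> S x.
  move=> Fv wv; apply: (fbl_eq_leval C_ex CX lT cT (wF x).1 Fv _ (cvgS x)).
  exact: eqF (wF x).1 Fv wv.
exists S; split.
- move=> a x y _ _.
  pose v n := LAdd (LScale a (w x n)) (w y n).
  have vS : (fun n => leval T (v n)) @ \oo --> a *: S x + S y.
    by apply: cvgD; [apply: cvgZr|].
  apply: cvg_unique vS => //; apply: limS.
    by move=> n; split; [exact: (wF x).1|exact: (wF y).1].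
  (* Four equivalences lead from [w (a *: x + y)] to [v]: return to the projection of delta_(ax+y),
     expand delta_(ax+y), use linearity of [Q], and replace each projection by its
     representative. *)
  have e1 : fbl_eq C setT (w (a *: x + y)) (Q (d (a *: x + y))).
    by apply: fbl_eq_sym.
  have e2 : fbl_eq C setT (Q (d (a *: x + y)))
                          (Q (fun n => LAdd (LScale a (d x n)) (d y n))).
    apply: Qeq; first exact: eltT.
      exact: (fbl_elt_cst C_ex
        (atoms_inT (LAdd (LScale a (LAtom R x)) (LAtom R y)))).
    (* The terms for delta_(ax+y) and a delta_x + delta_y are different syntactically, but every
       linear operator gives them the same value. *)
    apply/(fbl_eqP C_ex (atT _) (atT _)) => e e0; near=> n.
    apply: rhoC_le => // Z U CZ lU cU.
    by rewrite leval_sub /= lU// subrr normr0 ltW.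
  have e3 := Qlin a _ _ (eltT x) (eltT y).
  have e4 : fbl_eq C setT (fun n => LAdd (LScale a (Q (d x) n)) (Q (d y) n)) v.
    have a0 : 0 < `|a| + 1 by rewrite ltr_wpDl.
    apply/(fbl_eqP C_ex (atT _) (atT _)) => e e0.
    have /(fbl_eqP C_ex (atT _) (atT _)) xe := wQ x.
    have /(fbl_eqP C_ex (atT _) (atT _)) ye := wQ y.
    have e20 : 0 < e / 2 by rewrite divr_gt0.
    near=> n; apply: rhoC_le => //; first exact: atoms_inT.
    move=> Z U CZ lU cU; rewrite leval_sub /= opprD addrACA -scalerBr -!leval_sub.
    rewrite [e]splitr (le_trans (ler_normD _ _))// lerD//.
      rewrite normrZ.
      apply: (@le_trans _ _ ((`|a| + 1) * rhoC C setT (LSub (Q (d x) n) (w x n)))).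
        by rewrite ler_pM// ?lerDl// rhoC_ge//; exact: atoms_inT.
      rewrite mulrC -ler_pdivlMr//; near: n; apply: xe; exact: divr_gt0.
    apply: (@le_trans _ _ (rhoC C setT (LSub (Q (d y) n) (w y n)))).
      by apply: rhoC_ge => //; exact: atoms_inT.
    by near: n; exact: ye.
  apply: (fbl_eq_trans C_ex (atT _) (atT _) (atT _) e1).
  apply: (fbl_eq_trans C_ex (atT _) (atT _) (atT _) e2).
  exact: (fbl_eq_trans C_ex (atT _) (atT _) (atT _) e3 e4).
- move=> x _.
  (* The chain is |S x| <= |w x| in FBL[F], which equals |w x| in FBL[E] by isometry, hence |Q
     delta_x| <= |delta_x| <= |x|. *)
  apply: (le_trans (fbl_leval_norm C_ex CX lT cT (wF x) (cvgS x))).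
  rewrite -(iso _ (wF x)) -(fbl_eq_norm C_ex (Qelt _ (eltT x)) (wT x) (wQ x)).
  apply: (le_trans (Qnorm _ (eltT x))); rewrite /fbl_norm lim_cst//.
  by apply: rhoC_le => // Y U CY lU cU; exact: cU.
(* For x in [F], delta_x is fixed by [Q], so its constant sequence is equivalent to [w x] and also
   computes [S x]. *)
- move=> x Fx; have vS : (fun n => leval T (d x n)) @ \oo --> T x by exact: cvg_cst.
  apply: cvg_unique vS => //; apply: limS => //.
  apply: (fbl_eq_trans C_ex (v := Q (d x))) => //; first exact: fbl_eq_sym.
  by apply: Qid; exact: fbl_elt_cst.
Unshelve. all: by end_near. Qed.

Lemma ext_proj_property : contraction_ext_property -> proj_property C F.
Proof.
move=> ext; split=> [v [Fv _]|].
  suff Ev : (fun n => rhoC C setT (v n)) = (fun n => rhoC C F (v n)).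
    by rewrite /fbl_norm Ev.
  by apply/funext => n; rewrite rhoC_sub_eq.
have [X [phi [CX lphi cphi nphi dense]]] := fbl_model C_ex F_sub.
have [S [lS cS Sphi]] := ext X phi CX lphi cphi.
have rhoE t : atoms_in F t -> rhoC C setT t = `|leval phi t|.
  by move=> Ft; rewrite rhoC_sub_eq// nphi.
have SE v : (forall n, atoms_in F (v n)) ->
    (fun n => leval S (v n)) = (fun n => leval phi (v n)).
  by move=> Fv; apply/funext => n; exact: eq_leval_in (Fv n).
have cvgS u : fbl_elt C setT u ->
    (fun n => leval S (u n)) @ \oo --> limn (fun n => leval S (u n)).
  exact: fbl_leval_cvg.
(* On terms over [F] the seminorm is the norm of the image in [X], so sequences with the same limit
   in [X] represent the same element. The algebraic properties of the projection all reduce to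
   comparing limits in [X]. *)
have eqX u v (l : X) : (forall n, atoms_in F (u n)) -> (forall n, atoms_in F (v n)) ->
    (fun n => leval phi (u n)) @ \oo --> l ->
    (fun n => leval phi (v n)) @ \oo --> l -> fbl_eq C setT u v.
  move=> Fu Fv ul vl; rewrite /fbl_eq.
  have -> : (fun n => rhoC C setT (LSub (u n) (v n))) =
            (fun n => `|leval phi (u n) - leval phi (v n)|).
    by apply/funext => n; rewrite rhoE ?leval_sub//; exact: atoms_in_sub.
  have := cvg_norm (cvgB ul vl); rewrite subrr normr0; exact.
have eltX v (l : X) : (forall n, atoms_in F (v n)) ->
    (fun n => leval phi (v n)) @ \oo --> l -> fbl_elt C F v.
  move=> Fv /cvgrPdist_lt vl; split=> // e e0.
  have [N _ NP] := vl _ (divr_gt0 e0 (ltr0Sn R 1)); exists N => n m Nn Nm.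
  rewrite -nphi ?leval_sub; last exact: atoms_in_sub.
  rewrite [e]splitr (le_lt_trans (ler_distD l _ _))// ltrD ?NP//.
  by rewrite distrC NP.
(* By density, the image of [u] under the extension of [S] is a limit of values of terms over [F].
   Convergence is a premise inside the statement, so it holds for every sequence [u] and [choice]
   yields a total function [Q]. *)
have approx u : exists v, (forall n, atoms_in F (v n)) /\ forall l : X,
    (fun n => leval S (u n)) @ \oo --> l -> (fun n => leval phi (v n)) @ \oo --> l.
  pose l := limn (fun n => leval S (u n)).
  have close n : exists t, atoms_in F t /\ `|l - leval phi t| <= n.+1%:R^-1.
    have n0 : 0 < n.+1%:R^-1 :> R by rewrite invr_gt0.
    by have [t Ft lt] := dense l _ n0; exists t.
  have [v vP] := choice close.
  exists v; split=> [n|l' ul']; first by have [] := vP n.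
  have <- : l = l' by exact: cvg_lim.
  apply/cvgrPdist_le => _/posnumP[e]; near=> n.
  have [_ /le_trans] := vP n; apply.
  by apply/ltW; near: n; exact: near_infty_natSinv_lt.
have [Q QP] := choice approx.
have QF u n : atoms_in F (Q u n) by have [] := QP u.
have Qlim u : fbl_elt C setT u ->
    (fun n => leval phi (Q u n)) @ \oo --> limn (fun n => leval S (u n)).
  by move=> eu; apply: (QP u).2; exact: cvgS.
have Qelt u : fbl_elt C setT u -> fbl_elt C F (Q u).
  by move=> eu; apply: eltX (Qlim u eu) => n; exact: QF.
have FT u : fbl_elt C F u -> fbl_elt C setT u.
  move=> [Fu cu]; split=> [n|e e0]; first exact: atoms_inT.
  have [N uN] := cu e e0; exists N => n m Nn Nm.
  by rewrite rhoC_sub_eq ?uN//; exact: atoms_in_sub.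
exists Q; split; first by move=> u /Qelt/FT.
split.
  move=> u v eu ev uv; apply: eqX (Qlim _ eu) _ => //.
  apply: (QP v).2.
  by apply: (fbl_eq_leval C_ex CX lS cS _ _ uv (cvgS u eu)) => n; exact: atoms_inT.
split.
  move=> a u v eu ev.
  apply: (eqX _ _ (a *: limn (fun n => leval S (u n)) +
                   limn (fun n => leval S (v n)))) => //.
  - by move=> n; split; exact: QF.
  - by apply: (QP _).2; apply: cvgD; [apply: cvgZr|]; exact: cvgS.
  - by apply: cvgD; [apply: cvgZr|]; exact: Qlim.
split.
  move=> u v eu ev.
  apply: (eqX _ _ (bl_sup (limn (fun n => leval S (u n)))
                          (limn (fun n => leval S (v n))))) => //.
  - by apply: (QP _).2; apply: cvg_bl_sup; exact: cvgS.
  - by apply: cvg_bl_sup; exact: Qlim.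
split.
  (* The norm of [Q u] equals that of the limit of [leval S (u n)] in [X], and the extension of [S]
     is contractive. *)
  move=> u eu; apply: le_trans (fbl_leval_norm C_ex CX lS cS eu (cvgS u eu)).
  rewrite le_eqVlt; apply/orP; left; apply/eqP; apply: cvg_lim => //.
  have -> : (fun n => rhoC C setT (Q u n)) = (fun n => `|leval phi (Q u n)|).
    by apply/funext => n; rewrite rhoE.
  by apply: cvg_norm; exact: Qlim.
split.
  move=> u eu; exists (Q u); split; first exact: Qelt.
  exact: eqX (Qlim _ eu) (Qlim _ eu).
(* On terms over [F], [S] and [phi] give the same values, so [v] and [Q v] have the same limit in
   [X]. *)
move=> v ev; have Fv := ev.1; apply: eqX (Qlim _ (FT _ ev)) _ => //.
by rewrite -SE//; exact/cvgS/FT.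
Unshelve. all: by end_near. Qed.

End Equivalence.

Theorem theorem5p4 (R : realType) (C : banachLattice R -> Prop)
  (E : completeNormedModType R) (F : set E) :
  (exists X, C X) -> lin_subspace F -> closed F ->
  (ext_property C F <-> proj_property C F).
Proof.
move=> C_ex F_sub _; rewrite (ext_property_contraction C F_sub).
by split; [exact: ext_proj_property|exact: proj_property_ext].
Qed.
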